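(* Let $X$ be a real Hilbert space, $Y$ a real Banach space, $A\subseteq X$ a nonempty closed convex set, $C\subseteq Y$ a closed convex cone with nonempty interior, and $F:X\to Y$ a continuous linear map with $F(X)\cap\operatorname{int}C\neq\emptyset$. Let $\theta$ be the associated merit function, assumed to satisfy $\theta(x)<+\infty$ for all $x\in X$, and let $\bar x\in E_w$. Assume that (i) there exist constants $\tau>0$, $\delta>0$ such that $d(x,E_w)\le\tau\,\theta(x)$ for all $x\in A\cap B(\bar x,\delta)$; (ii) there exists $\eta>0$ such that $E_w\cap B(\bar x,\eta)$ is convex. Then for any $d\in T_A(\bar x)$, $$\theta'(\bar x;d)\ge\frac1\tau\operatorname{dist}\bigl(d,T_{E_w}(\bar x)\bigr).$$
   Context: $\operatorname{dist}(x,D)=d(x,D)=d_D(x)=\inf_{u\in D}\|x-u\|$ with $d_\emptyset\equiv+\infty$; $\Delta_D(y)=d_D(y)-d_{Y\setminus D}(y)$ with conventions $\Delta_\emptyset\equiv+\infty$, $\Delta_Y\equiv-\infty$. $C^+=\{y^*\in Y^*:\langle y^*,c\rangle\ge 0\ \forall c\in C\}$, $S(C^+)=\{y^*\in C^+:\|y^*\|=1\}$. The merit function is $$\theta(x)=\sup_{a\in A}\bigl(-\Delta_C(F(x)-F(a))\bigr)=\sup_{a\in A}\inf_{y^*\in S(C^+)}\langle y^*,F(x)-F(a)\rangle .$$ $E_w=\{\bar x\in A: F(\bar x)\notin F(A)+\operatorname{int}C\}$ is the weakly efficient solution set. For a nonempty set $D\subseteq X$ and $x\in D$, $T_D(x)=\{d\in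 X:\exists t_k\downarrow0,\ \exists d_k\to d,\ x+t_kd_k\in D\}$. $B(x,r)$ is the open ball. $\theta'(x;d)=\lim_{t\downarrow0}\frac{\theta(x+td)-\theta(x)}{t}$, which exists and is finite since $\theta$ is concave and Lipschitz. *)

(* Defs.v *)
From HB Require Import structures.
From mathcomp Require Import all_boot all_order all_algebra.
From mathcomp Require Import all_classical all_reals all_analysis.
Import Order.TTheory GRing.Theory Num.Theory.
Import numFieldNormedType.Exports.

Set Implicit Arguments.
Unset Strict Implicit.
Unset Printing Implicit Defensive.

Local Open Scope classical_set_scope.
Local Open Scope ring_scope.

(* Extended-real valued, so that the distance to the empty set is [+oo]. *)
Definition dist (R : realType) (V : normedModType R) (x : V) (D : set V)
    : \bar R :=
  ereal_inf [set `|x - u|%:E | u in D].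

(* The oriented distance.  No case split is needed: for [D = set0] this is
   [+oo - 0 = +oo], for [D = setT] it is [0 - +oo = -oo]; in all other cases
   both distances are finite. *)
Definition oriented_dist (R : realType) (V : normedModType R) (D : set V)
    (y : V) : \bar R :=
  (dist y D - dist y (~` D))%E.

Definition is_cone (R : realType) (V : lmodType R) (C : set V) : Prop :=
  forall (t : R) (c : V), 0 <= t -> C c -> C (t *: c).

Definition merit (R : realType) (X Y : normedModType R) (A : set X)
    (C : set Y) (F : X -> Y) (x : X) : \bar R :=
  ereal_sup [set (- oriented_dist C (F x - F a)%R)%E | a in A].

Definition weakly_efficient (R : realType) (X Y : normedModType R) (A : set X)
    (C : set Y) (F : X -> Y) : set X :=
  [set x | A x /\ ~ [set u + c | u in F @` A & c in interior C] (F x)].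

Definition tangent_cone (R : realType) (X : normedModType R) (D : set X)
    (x : X) : set X :=
  [set d | exists (t : nat -> R) (dk : nat -> X),
    [/\ forall k, 0 < t k, t @ \oo --> (0 : R), dk @ \oo --> d &
        forall k, D (x + t k *: dk k)]].

Definition dir_deriv (R : realType) (X : normedModType R) (f : X -> R)
    (x d : X) : R :=
  lim ((f (x + t *: d) - f x) / t @[t --> (0 : R)^'+]).

(* Main.v *)
(* For every y, [- Delta_C y] is the supremum of [r - |y - z|] over the balls
   [B(z, r)] contained in C with centre z in C (r = 0 allowed).  Hence theta is
   the supremum of [r - |F x - F a - z|] over such balls and a in A; since A is
   convex and C is a cone this makes theta Lipschitz and
   [theta (xbar + s h) >= s theta (xbar + h)] for 0 < s <= 1, so that
   [theta (xbar + t d) / t] increases to [theta'(xbar; d)] as t decreases to 0.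
   Given [x_k = xbar + t_k d_k] in A with d_k -> d, choose u_k in E_w almost
   nearest to x_k.  Then u_k -> xbar, local convexity puts [(u_k - xbar) / t_k]
   in the tangent cone of E_w, and its distance to d is at most
   [|d - d_k| + d(x_k, E_w) / t_k <= tau theta'(xbar; d) + o(1)]. *)
Require Import Defs.
From HB Require Import structures.
From mathcomp Require Import all_boot all_order all_algebra.
From mathcomp Require Import all_classical all_reals all_analysis.
From mathcomp Require Import ring lra.
Import Order.TTheory GRing.Theory Num.Theory.
Import numFieldNormedType.Exports.

Set Implicit Arguments.
Unset Strict Implicit.
Unset Printing Implicit Defensive.

Local Open Scope classical_set_scope.
Local Open Scope ring_scope.

Lemma convex_setW (R : numDomainType) (V : lmodType R) (D : set V) (x y : V)
    (s : R) :
  convex_set D -> D x -> D y -> 0 <= s -> s <= 1 -> D (s *: x + (1 - s) *: y).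
Proof.
move=> Dc Dx Dy s0 s1.
by have := Dc x y (Itv01 s0 s1) (mem_set Dx) (mem_set Dy) => /set_mem.
Qed.

(** * Distances and the oriented distance *)

Lemma dist_le (R : realType) (V : normedModType R) (D : set V) (x u : V) :
  D u -> (dist x D <= `|x - u|%:E)%E.
Proof. by move=> Du; apply: ereal_inf_lbound; exists u. Qed.

Lemma dist_fin (R : realType) (V : normedModType R) (D : set V) (x : V) :
  D !=set0 -> exists r : R, [/\ dist x D = r%:E, 0 <= r,
    forall u, D u -> r <= `|x - u| &
    forall e, 0 < e -> exists2 u, D u & `|x - u| < r + e].
Proof.
case=> u0 Du0.
have d0 : (0 <= dist x D)%E.
  by apply: le_ereal_inf_tmp => _ [u _ <-]; rewrite lee_fin.
have dfin : dist x D \is a fin_num.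
  by rewrite ge0_fin_numE// (le_lt_trans (dist_le x Du0))// ltry.
move: (dfin) => /fineK dE.
exists (fine (dist x D)); split=> //.
- exact: fine_ge0.
- by move=> u Du; rewrite -lee_fin dE; exact: dist_le.
- move=> e e0; have [_ [u Du <-] ulte] := lb_ereal_inf_adherent e0 dfin.
  by exists u => //; rewrite -lte_fin EFinD dE.
Qed.

(** For [r = 0] the ball condition is vacuous, so every point of [C] is a centre; one supremum then
    covers points inside and outside [C]. *)
Definition inner_ball (R : realType) (V : normedModType R) (C : set V)
    (z : V) (r : R) : Prop :=
  [/\ C z, 0 <= r & forall w, `|z - w| < r -> C w].

Lemma inner_ball_dist_compl (R : realType) (V : normedModType R) (C : set V)
    (y z : V) (r q : R) : inner_ball C z r ->
  (forall e, 0 < e -> exists2 w, ~ C w & `|y - w| < q + e) ->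
  r - `|y - z| <= q.
Proof.
move=> [_ _ Cr] qe; apply/ler_addgt0Pr => e e0.
have [w Cw wlt] := qe _ e0.
have rw : r <= `|z - w| by rewrite leNgt; apply/negP => /Cr.
have : `|z - w| <= `|y - z| + `|y - w|.
  by rewrite (distrC y z); exact: ler_distD.
lra.
Qed.

(** Walking from [z] towards [y] stays in [C] for any length below [r]; the rest of the segment has
    length tending to [|y - z| - r]. *)
Lemma inner_ball_dist (R : realType) (V : normedModType R) (C : set V)
    (y z : V) (r p : R) : inner_ball C z r -> ~ C y ->
  (forall u, C u -> p <= `|y - u|) -> p <= `|y - z| - r.
Proof.
move=> [Cz r0 Cr] Cy pC.
move: r0; rewrite le_eqVlt => /predU1P[<-|r0]; first by rewrite subr0; exact: pC.
have rN : r <= `|y - z| by rewrite distrC leNgt; apply/negP => /Cr.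
have N0 : 0 < `|y - z| by exact: lt_le_trans rN.
apply/ler_addgt0Pr => e e0.
have re0 : 0 < r + e by lra.
(* The point of the segment [z, y] at distance [r^2 / (r + e) < r] from [z]. *)
pose k := r ^+ 2 / (r + e).
have k0 : 0 <= k by rewrite divr_ge0// ?sqr_ge0// ltW.
have kr : k < r by rewrite ltr_pdivrMr// expr2 ltr_pM2l// ltrDl.
have rk : r - k <= e.
  rewrite lerBlDr -lerBlDl ler_pdivlMr//.
  have -> : (r - e) * (r + e) = r ^+ 2 - e ^+ 2 by ring.
  by rewrite gerBl sqr_ge0.
pose s := k / `|y - z|.
have sN : s * `|y - z| = k by rewrite mulfVK// gt_eqF.
have s0 : 0 <= s by rewrite divr_ge0.
have s1 : s <= 1 by rewrite ler_pdivrMr// mul1r; lra.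
have : C (z + s *: (y - z)).
  by apply: Cr; rewrite opprD addrA subrr sub0r normrN normrZ ger0_norm// sN.
move=> /pC /le_trans; apply.
have -> : y - (z + s *: (y - z)) = (1 - s) *: (y - z).
  by rewrite opprD addrA scalerBl scale1r.
rewrite normrZ ger0_norm ?subr_ge0// mulrBl mul1r sN; lra.
Qed.

(* The two halves say [- Delta_C y = sup {r - |y - z| : inner_ball C z r}]. *)
Lemma oriented_dist_inner_ball (R : realType) (V : normedModType R)
    (C : set V) (y : V) : C !=set0 -> ~` C !=set0 ->
  exists g : R, [/\ oriented_dist C y = g%:E,
    forall z r, inner_ball C z r -> r - `|y - z| <= - g &
    forall e, 0 < e -> exists z r, inner_ball C z r /\ - g < r - `|y - z| + e].
Proof.
move=> C0 Cc0.
have [p [pE p0 pC pe]] := dist_fin y C0.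
have [q [qE q0 qC qe]] := dist_fin y Cc0.
exists (p - q); split; first by rewrite /oriented_dist pE qE.
- move=> z r zr; have [Cy|Cy] := pselect (C y).
    have := inner_ball_dist_compl zr qe.
    have := pC _ Cy; rewrite subrr normr0; lra.
  have := inner_ball_dist zr Cy pC.
  have := qC _ Cy; rewrite subrr normr0; lra.
(* Inside [C], take the ball centred at [y] whose radius is the distance to the complement; outside,
   a nearly closest point of [C] with radius 0. *)
- move=> e e0; have [Cy|Cy] := pselect (C y).
    exists y, q; split; last by rewrite subrr normr0; lra.
    by split=> // w yw; apply: contrapT => /qC; rewrite leNgt yw.
  have [z Cz zlt] := pe _ e0.
  exists z, 0; split; first by split=> // w; rewrite ltNge normr_ge0.
  have := qC _ Cy; rewrite subrr normr0; lra.
Qed.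

(** * The merit function *)

Lemma compl_neq0_of_merit (R : realType) (X Y : normedModType R) (A : set X)
    (C : set Y) (F : X -> Y) (x : X) : A !=set0 -> C !=set0 ->
  (merit A C F x < +oo)%E -> ~` C !=set0.
Proof.
move=> [a Aa] C0 fin; apply: contrapT => /set0P/negP; rewrite negbK => /eqP Cc.
suff : merit A C F x = +oo%E by move=> E; move: fin; rewrite E ltxx.
(* The distance to an empty complement is [+oo], so [oriented_dist] would be [-oo] at every
   point. *)
apply/eqP; rewrite -leye_eq; apply: ereal_sup_ubound; exists a => //.
have [p [pE _ _ _]] := dist_fin (F x - F a) C0.
by rewrite /oriented_dist pE Cc /dist image_set0 ereal_inf0 oppeD.
Qed.

(** Merges the suprema over [A] and over inner balls into a single real one, given by its bound and
    approximation properties. *)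
Lemma merit_inner_ball (R : realType) (X Y : normedModType R) (A : set X)
    (C : set Y) (F : X -> Y) (x : X) : A !=set0 -> C !=set0 ->
  (merit A C F x < +oo)%E ->
  [/\ merit A C F x = (fine (merit A C F x))%:E,
    forall a z r, A a -> inner_ball C z r ->
      r - `|F x - F a - z| <= fine (merit A C F x) &
    forall e, 0 < e -> exists a z r, [/\ A a, inner_ball C z r &
      fine (merit A C F x) < r - `|F x - F a - z| + e]].
Proof.
move=> A0 C0 mfin.
have Cc0 := compl_neq0_of_merit A0 C0 mfin.
have le_m a z r : A a -> inner_ball C z r ->
    ((r - `|F x - F a - z|)%:E <= merit A C F x)%E.
  move=> Aa zr; have [g [gE gle _]] := oriented_dist_inner_ball (F x - F a) C0 Cc0.
  apply: (@le_trans _ _ (- oriented_dist C (F x - F a)%R)%E).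
    by rewrite gE lee_fin; exact: gle.
  by apply: ereal_sup_ubound; exists a.
have mfn : merit A C F x \is a fin_num.
  have [a Aa] := A0; have [c Cc] := C0.
  rewrite fin_numE (lt_eqF mfin) andbT -ltNye.
  apply: lt_le_trans (le_m a c 0 Aa _); first by rewrite ltNyr.
  by split=> // w; rewrite ltNge normr_ge0.
have mE := fineK mfn; split=> //.
  by move=> a z r Aa zr; rewrite -lee_fin mE; exact: le_m.
move=> e e0; have e20 : 0 < e / 2 by lra.
have [_ [a Aa <-]] := ub_ereal_sup_adherent e20 mfn.
have [g [-> _ ge]] := oriented_dist_inner_ball (F x - F a) C0 Cc0.
rewrite -/(merit A C F x) -mE -EFinN -EFinN -EFinD lte_fin => mg.
have [z [r [zr gr]]] := ge _ e20.
by exists a, z, r; split=> //; lra.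
Qed.

(** A nearly optimal triple [a], [z], [r] for [x] also competes at [y], with a loss of at most
    [|F x - F y|]. *)
Lemma merit_lipschitz (R : realType) (X Y : normedModType R) (A : set X)
    (C : set Y) (F : X -> Y) (x y : X) : A !=set0 -> C !=set0 ->
  (forall x, (merit A C F x < +oo)%E) ->
  fine (merit A C F x) <= fine (merit A C F y) + `|F x - F y|.
Proof.
move=> A0 C0 mfin; apply/ler_addgt0Pr => e e0.
have [_ _ /(_ _ e0)[a [z [r [Aa zr xlt]]]]] := merit_inner_ball A0 C0 (mfin x).
have [_ /(_ _ _ _ Aa zr) + _] := merit_inner_ball A0 C0 (mfin y).
have : `|F y - F a - z| <= `|F x - F y| + `|F x - F a - z|.
  rewrite (distrC (F x)).
  have -> : F y - F a - z = (F y - F x) + (F x - F a - z).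
    by rewrite !addrA subrK.
  exact: ler_normD.
lra.
Qed.

Lemma inner_ball_scale (R : realType) (V : normedModType R) (C : set V)
    (z : V) (r s : R) : is_cone C -> 0 < s -> inner_ball C z r ->
  inner_ball C (s *: z) (s * r).
Proof.
move=> Ccone s0 [Cz r0 Cr]; split; first by apply: Ccone => //; exact: ltW.
  by rewrite mulr_ge0// ltW.
move=> w; have -> : w = s *: (s^-1 *: w) by rewrite scalerA mulfV ?scale1r// gt_eqF.
rewrite -scalerBr normrZ gtr0_norm// ltr_pM2l// => /Cr.
by apply: Ccone; exact: ltW.
Qed.

(** If [a], [z], [r] is nearly optimal for [x + h], then [s *: a + (1 - s) *: x], [s *: z], [s * r]
    competes at [x + s *: h] with exactly [s] times the value. *)
Lemma merit_concave_at (R : realType) (X Y : normedModType R) (A : set X)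
    (C : set Y) (F : {linear X -> Y}) (x h : X) (s : R) :
  convex_set A -> is_cone C -> C !=set0 ->
  (forall x, (merit A C F x < +oo)%E) -> A x -> 0 < s -> s <= 1 ->
  s * fine (merit A C F (x + h)) <= fine (merit A C F (x + s *: h)).
Proof.
move=> Ac Ccone C0 mfin Ax s0 s1.
have A0 : A !=set0 by exists x.
apply/ler_addgt0Pr => e e0.
have [_ _ /(_ _ e0)[a [z [r [Aa zr mlt]]]]] := merit_inner_ball A0 C0 (mfin (x + h)).
have Aa' := convex_setW Ac Aa Ax (ltW s0) s1.
have [_ /(_ _ _ _ Aa' (inner_ball_scale Ccone s0 zr)) + _] :=
  merit_inner_ball A0 C0 (mfin (x + s *: h)).
have -> : F (x + s *: h) - F (s *: a + (1 - s) *: x) - s *: z =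
    s *: (F (x + h) - F a - z).
  rewrite (linearD F x h) (linearD F x) (linearD F (s *: a)) !(linearZZ F).
  rewrite !scalerBr scalerDr scalerBl scale1r opprD opprB; congr (_ - _).
  rewrite addrCA (addrC _ (- F x)) addrACA subrr add0r addrC.
  by rewrite (addrC (s *: F h)).
rewrite normrZ gtr0_norm// => m'le.
have : s * fine (merit A C F (x + h)) <= s * (r - `|F (x + h) - F a - z| + e).
  by rewrite ler_pM2l// ltW.
have : s * e <= e by rewrite ler_piMl// ltW.
rewrite mulrDr mulrBr; lra.
Qed.

(** * Slopes, tangent directions and zeros of the merit function *)

Lemma linear_lipschitz (R : realType) (X Y : normedModType R)
    (F : {linear X -> Y}) : continuous F ->
  exists2 L, 0 < L & forall x, `|F x| <= L * `|x|.
Proof.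
move=> Fc.
have /linear_boundedP/pinfty_ex_gt0 [L L0 FL] :=
  (linear_bounded_continuous F).2 Fc.
by exists L.
Qed.

(* The difference quotient is nonincreasing, so its limit is its supremum. *)
Lemma quotient_le_dir_deriv (R : realType) (X : normedModType R) (f : X -> R)
    (x d : X) (M : R) :
  (forall h (s : R), 0 < s -> s <= 1 ->
    s * (f (x + h) - f x) <= f (x + s *: h) - f x) ->
  (forall h, f (x + h) - f x <= M * `|h|) ->
  forall t : R, 0 < t -> (f (x + t *: d) - f x) / t <= dir_deriv f x d.
Proof.
move=> fconc fM t t0.
pose q t := (f (x + t *: d) - f x) / t.
have qle s : 0 < s -> q s <= M * `|d|.
  move=> s0; rewrite ler_pdivrMr// (le_trans (fM _))// normrZ gtr0_norm//.
  by rewrite (mulrC s) mulrA.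
have ub : has_ubound (q @` [set` `]0, +oo[%R]).
  by exists (M * `|d|) => _ [s /= + <-]; rewrite in_itv/= andbT; exact: qle.
have mono : {in `]0, +oo[ &, nonincreasing_fun q}.
  move=> u v; rewrite !in_itv/= !andbT => u0 v0 uv.
  have s0 : 0 < u / v by rewrite divr_gt0.
  have s1 : u / v <= 1 by rewrite ler_pdivrMr// mul1r.
  (* Passing from [v] to the smaller [u] shrinks the displacement [v *: d] by the factor [u / v]. *)
  have := fconc (v *: d) _ s0 s1.
  rewrite scalerA divfK ?gt_eqF// /q => fc.
  by rewrite ler_pdivlMr// mulrC mulrCA mulrC.
have qcvg := nonincreasing_at_right_cvgr (isT : (BRight 0 < BInfty R false)%O) mono ub.
rewrite /dir_deriv (cvg_lim _ qcvg)//.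
apply: ub_le_sup => //; exists t => //.
by rewrite /= in_itv/= t0.
Qed.

(** The segment from [x] to [u] lies in [D], so steps [t / (k + 1)] in one constant direction stay
    in [D]. *)
Lemma tangent_cone_locally_convex (R : realType) (X : normedModType R)
    (D : set X) (x u : X) (eta t : R) :
  convex_set (D `&` ball x eta) -> 0 < eta -> 0 < t -> D x -> D u ->
  ball x eta u -> tangent_cone D x (t^-1 *: (u - x)).
Proof.
move=> Dc eta0 t0 Dx Du xu.
exists (fun k => t * harmonic k), (fun=> t^-1 *: (u - x)); split.
- by move=> k; rewrite mulr_gt0// harmonic_gt0.
- rewrite -[X in _ --> X](mulr0 t).
  by apply: cvgM; [exact: cvg_cst|exact: cvg_harmonic].
- exact: cvg_cst.
- move=> k; set s : R := harmonic k.
  have s0 : 0 <= s by exact: harmonic_ge0.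
  have s1 : s <= 1 by rewrite /s/harmonic/= invf_le1// ler1n.
  have xx : ball x eta x by exact: ballxx.
  have [+ _] := convex_setW Dc (conj Du xu) (conj Dx xx) s0 s1.
  rewrite scalerA mulrAC mulfV ?gt_eqF// mul1r scalerBl scale1r scalerBr.
  by rewrite addrCA.
Qed.

(** The choice [a = x], [z = 0], [r = 0] gives the value 0. A positive value would put some
    [F x - F a] strictly inside an inner ball, hence in the interior of [C]. *)
Lemma weakly_efficient_merit0 (R : realType) (X Y : normedModType R) (A : set X)
    (C : set Y) (F : X -> Y) (x : X) : C 0 -> (merit A C F x < +oo)%E ->
  weakly_efficient A C F x -> fine (merit A C F x) = 0.
Proof.
move=> C0 mfin [Ax xw].
have A0 : A !=set0 by exists x.
have Cn0 : C !=set0 by exists 0.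
have [_ mge mlt] := merit_inner_ball A0 Cn0 mfin.
apply/eqP; rewrite eq_le; apply/andP; split; last first.
  have := mge x 0 0 Ax; rewrite subrr subr0 normr0 subr0; apply.
  by split=> // w; rewrite ltNge normr_ge0.
rewrite leNgt; apply/negP => m0.
have [a [z [r [Aa [Cz r0 Cr] mr]]]] := mlt _ m0.
have zr : `|z - (F x - F a)| < r by rewrite distrC; lra.
apply: xw; exists (F a); first by exists a.
exists (F x - F a); last by rewrite addrC subrK.
have e0 : 0 < r - `|z - (F x - F a)| by lra.
apply/nbhs_ballP; exists (r - `|z - (F x - F a)|) => // w.
rewrite -ball_normE /= => ew; apply: Cr.
by have := ler_distD (F x - F a) z w; lra.
Qed.

(** * The slope estimate *)

Theorem theorem5p8 (R : realType)
    (X : completeNormedModType R) (ip : {dot X for idfun})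
    (X_hilbert : forall x : X, `|x| ^+ 2 = ip x x)
    (Y : completeNormedModType R)
    (A : set X) (A_neq0 : A !=set0) (A_closed : closed A)
    (A_convex : convex_set A)
    (C : set Y) (C_closed : closed C) (C_convex : convex_set C)
    (C_cone : is_cone C) (C_int : interior C !=set0)
    (F : {linear X -> Y}) (F_cont : continuous F)
    (F_int : range F `&` interior C !=set0)
    (theta_fin : forall x : X, (merit A C F x < +oo)%E)
    (xbar : X) (xbar_Ew : weakly_efficient A C F xbar)
    (tau delta : R) (tau_gt0 : 0 < tau) (delta_gt0 : 0 < delta)
    (error_bound : forall x : X, (A `&` ball xbar delta) x ->
      (dist x (weakly_efficient A C F) <= tau%:E * merit A C F x)%E)
    (eta : R) (eta_gt0 : 0 < eta)
    (Ew_loc_convex : convex_set (weakly_efficient A C F `&` ball xbar eta))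
    (d : X) (d_tangent : tangent_cone A xbar d) :
  ((dir_deriv (fun x => fine (merit A C F x)) xbar d)%:E >=
   (1 / tau)%:E * dist d (tangent_cone (weakly_efficient A C F) xbar))%E.
Proof.
set Ew := weakly_efficient A C F.
set theta := fun x => fine (merit A C F x).
have [Axbar _] := xbar_Ew.
have Cn0 : C !=set0 by have [c /interior_subset Cc] := C_int; exists c.
have C0 : C 0 by have [c /(C_cone 0 c (lexx 0))] := Cn0; rewrite scale0r.
have theta0 : theta xbar = 0 by exact: weakly_efficient_merit0.
have [L L0 FL] := linear_lipschitz F_cont.
have theta_lip x y : theta x <= theta y + L * `|x - y|.
  apply: le_trans (merit_lipschitz x y A_neq0 Cn0 theta_fin) _.
  by apply: lerD => //; rewrite -(linearB F); exact: FL.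
set D := dir_deriv theta xbar d.
have quot (t : R) : 0 < t -> theta (xbar + t *: d) <= D * t.
  move=> t0; rewrite -ler_pdivrMr// -[X in X / t]subr0 -theta0.
  apply: (@quotient_le_dir_deriv _ _ theta xbar d L) => //.
    by move=> h s s0 s1; rewrite theta0 !subr0; exact: merit_concave_at.
  by move=> h; rewrite lerBlDl (le_trans (theta_lip _ xbar))// addrAC subrr add0r.
(* The zero direction is tangent, so the distance to the cone is a real number [rho]. *)
have T0 : tangent_cone Ew xbar !=set0.
  exists (1^-1 *: (xbar - xbar)).
  apply: (tangent_cone_locally_convex Ew_loc_convex) => //; exact: ballxx.
have [rho [rhoE _ rhoT _]] := dist_fin d T0.
rewrite rhoE -EFinM lee_fin mul1r mulrC ler_pdivrMr//.
have [tk [dk [tk0 tkc dkc Ak]]] := d_tangent.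
have K0 : 0 < 2 + tau * L by rewrite ltr_wpDr// mulr_ge0// ltW.
apply/ler_addgt0Pr => e' e'0.
(* The errors are [e] from [|d - dk k|], [e] from the choice of [u], and [tau * L * e] from
   replacing [dk k] by [d] in [theta]. *)
pose e := Num.min 1 (e' / (2 + tau * L)).
have e0 : 0 < e by rewrite lt_min ltr01 divr_gt0.
have e1 : e <= 1 by rewrite ge_min lexx.
have ee' : (2 + tau * L) * e <= e'.
  by rewrite mulrC -ler_pdivlMr// ge_min lexx orbT.
(* Both [p] and [|x - xbar|] will be at most [t * (|d| + 1)], and [|x - u| < p + t]; so this puts
   [x] within [delta] and [u] within [eta] of [xbar]. *)
pose c := Num.min delta eta / (2 * (`|d| + 1) + 1).
have dd0 : 0 < 2 * (`|d| + 1) + 1 by have := normr_ge0 d; lra.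
have c0 : 0 < c by rewrite divr_gt0// lt_min delta_gt0.
have [k [dke tkc']] : exists k, `|d - dk k| < e /\ tk k < c.
  have /cvgrPdist_lt/(_ _ e0) near_d := dkc.
  have /cvgrPdist_lt/(_ _ c0) near_t := tkc.
  have [k [? tkk]] := filter_ex (filterI near_d near_t).
  by exists k; split=> //; move: tkk; rewrite sub0r normrN gtr0_norm.
have t0 := tk0 k; set t := tk k in t0 tkc'.
pose x := xbar + t *: dk k.
have Ax : A x by exact: Ak.
have dkn : `|dk k| <= `|d| + 1.
  have := ler_normB d (d - dk k); rewrite opprB addrC subrK; lra.
have xxbar : `|x - xbar| = t * `|dk k|.
  by rewrite /x addrAC subrr add0r normrZ gtr0_norm.
have tsmall : t * (2 * (`|d| + 1) + 1) < Num.min delta eta by rewrite -ltr_pdivlMr.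
have t_min : t * (2 * (`|d| + 1) + 1) < delta /\ t * (2 * (`|d| + 1) + 1) < eta.
  by move: tsmall; rewrite lt_min => /andP.
have tdk : t * `|dk k| <= t * (`|d| + 1) by rewrite ler_pM2l.
have td0 : 0 <= t * (`|d| + 1) by rewrite mulr_ge0 ?addr_ge0// ltW.
have Ew0 : Ew !=set0 by exists xbar.
have [p [pE _ pEw pe]] := dist_fin x Ew0.
have ptau : p <= tau * theta x.
  have /error_bound : (A `&` ball xbar delta) x.
    by split=> //; rewrite -ball_normE /= distrC xxbar; lra.
  have [-> _ _] := merit_inner_ball A_neq0 Cn0 (theta_fin x).
  by rewrite -/Ew pE -EFinM lee_fin.
(* The tolerance is proportional to [t], so that it costs only [e] after division by [t]. *)
have te0 : 0 < t * e by exact: mulr_gt0.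
have te1 : t * e <= t by rewrite ger_pMr.
have [u Eu xu] := pe _ te0.
have pxbar := pEw _ xbar_Ew.
have xbaru : ball xbar eta u.
  rewrite -ball_normE /=.
  have := ler_distD x xbar u; rewrite (distrC xbar x); lra.
have := rhoT _ (tangent_cone_locally_convex Ew_loc_convex eta_gt0 t0 xbar_Ew Eu xbaru).
(* Since [x = xbar + t *: dk k], the tangent vector differs from [dk k] by [t^-1 *: (x - u)]. *)
have -> : d - t^-1 *: (u - xbar) = (d - dk k) + t^-1 *: (x - u).
  have -> : x - u = t *: dk k - (u - xbar) by rewrite /x opprB addrAC addrC.
  rewrite (scalerBr _ (t *: dk k)) scalerA mulVf ?gt_eqF// scale1r.
  by rewrite addrA subrK.
move=> rle; have := le_trans rle (ler_normD _ _).
rewrite normrZ gtr0_norm ?invr_gt0// => {}rle.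
(* The slope bounds [theta] at [xbar + t *: d]; the Lipschitz estimate carries the bound to [x]. *)
have thx : theta x <= D * t + L * (t * e).
  have := theta_lip x (xbar + t *: d); have := quot _ t0.
  have -> : x - (xbar + t *: d) = t *: (dk k - d).
    by rewrite /x opprD addrACA subrr add0r scalerBr.
  rewrite normrZ gtr0_norm// (distrC (dk k)).
  have : L * (t * `|d - dk k|) <= L * (t * e) by rewrite ler_pM2l// ler_pM2l// ltW.
  lra.
have : t^-1 * `|x - u| <= tau * (D + L * e) + e.
  rewrite mulrC ler_pdivrMr//.
  have : tau * theta x <= tau * (D * t + L * (t * e)) by rewrite ler_pM2l.
  lra.
lra.
Qed.
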